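(* Each of the systems $\mathsf{DG}+(\mathsf{BCT}_C)^{\mathrm{st}}$, $\mathsf{DG}+(\mathsf{WC\text{-}N}_0)^{\mathrm{st}}$ and $\mathsf{DG}+\mathsf{SE}^{\mathrm{st}}$ is inconsistent. Here: $\mathsf{BCT}_C$ is $(\forall Y^{2})(\forall f\le_1 1)(\exists N^{0})(\forall g\le_1 1)\big(\overline{f}N=\overline{g}N\rightarrow Y(f)=Y(g)\big)$; $\mathsf{WC\text{-}N}_0$ is the schema $(\forall\alpha^{1})(\exists n^{0})A(\alpha,n)\rightarrow(\forall\alpha^{1})(\exists n^0,m^0)(\forall\beta^{1})\big[\overline{\alpha}n=\overline{\beta}n\rightarrow A(\beta,m)\big]$ for quantifier-free internal formulas $A$; $\mathsf{SE}$ is $(\forall Y^{2},f^{1},g^{1})\big(Y(f)\neq_0 Y(g)\rightarrow f\neq_1 g\big)$, with $f\neq_1 g$ meaning $(\exists n^0)(f(n)\neq g(n))$; and for an internal formula $A$, $A^{\mathrm{st}}$ denotes $A$ with all quantifiers (except bounded number quantifiers) relativised to $\mathrm{st}$ (for a schema, the schema of the relativised instances).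
   Context: $\overline{f}N=\langle f(0),\dots,f(N-1)\rangle$. Finite types: $0$ is a type and if $\rho,\sigma$ are types so is $\rho\to\sigma$; type $1=0\to0$, $2=1\to0$. $\mathsf{E\text{-}HA}^{\omega}$ is Heyting arithmetic in all finite types (intuitionistic logic, Gödel's $T$ constants) with extensionality. Equality $=_0$ is primitive; for $\tau=\tau_1\to\dots\to\tau_k\to0$, $x=_\tau y$ abbreviates $(\forall z_1\dots z_k)(xz_1\dots z_k=_0yz_1\dots z_k)$, and $\le_\tau$ likewise. Extensionality $(\mathsf E_{\rho\to\tau})$: $(\forall\varphi)(\forall x,y)(x=_\rho y\to\varphi(x)=_\tau\varphi(y))$, for all types. Binary sequences: $f\le_1 1$. Strong majorizability (Howard–Bezem): $x\le^*_0 y$ iff $x\le_0 y$; $x\le^*_{\rho\to\sigma}y$ iff for all $u,v$ with $u\le^*_\rho v$: $xu\le^*_\sigma yv$ and $yu\le^*_\sigma yv$. Monotone: $x\le^*x$; $\tilde\forall,\tilde\exists$ range over monotone objects. The language of $\mathsf{DG}$ adds predicates $\mathrm{st}^\sigma$ (''is standard''); $\forall^{\mathrm{st}},\exists^{\mathrm{st}}$ are the relativised quantifiers, $\tilde\forall^{\mathrm{st}},\tilde\exists^{\mathrm{st}}$ combine both restrictions. Internal = not containing $\mathrm{st}$. $\mathsf{DG}$ is $\mathsf{E\text{-}HA}^\omega$ in the extended language plus: (a) $x=_\sigma y\to(\mathrm{st}(x)\to\mathrm{st}(y))$; (b) $\mathrm{st}(y)\to(x\le^*_\sigma y\to\mathrm{st}(x))$;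 (c) $\mathrm{st}(t)$ for closed terms $t$; (d) $\mathrm{st}(z)\to(\mathrm{st}(x)\to\mathrm{st}(zx))$; external induction $\Phi(0)\wedge(\forall^{\mathrm{st}}n)(\Phi(n)\to\Phi(n+1))\to(\forall^{\mathrm{st}}n)\Phi(n)$ for any $\Phi$; and for arbitrary $\Phi,\Psi$ and internal $\phi,\psi$: $\mathsf{mAC}^\omega$: $(\tilde\forall^{\mathrm{st}}x)(\tilde\exists^{\mathrm{st}}y)\Phi(x,y)\to(\tilde\exists^{\mathrm{st}}f)(\tilde\forall^{\mathrm{st}}x)(\exists y\le^*f(x))\Phi(x,y)$; $\mathsf R^\omega$: $(\forall x)(\exists^{\mathrm{st}}y)\Phi(x,y)\to(\tilde\exists^{\mathrm{st}}z)(\forall x)(\exists y\le^*z)\Phi(x,y)$; $\mathsf I^\omega$: $(\tilde\forall^{\mathrm{st}}z)(\exists x)(\forall y\le^*z)\phi(x,y)\to(\exists x)(\forall^{\mathrm{st}}y)\phi(x,y)$; $\mathsf{IP}^\omega_{\tilde\forall^{\mathrm{st}}}$: $[(\tilde\forall^{\mathrm{st}}x)\phi(x)\to(\tilde\exists^{\mathrm{st}}y)\Psi(y)]\to(\tilde\exists^{\mathrm{st}}z)[(\tilde\forall^{\mathrm{st}}x)\phi(x)\to(\tilde\exists y\le^*z)\Psi(y)]$; $\mathsf M^\omega$: $[(\tilde\forall^{\mathrm{st}}x)\phi(x)\to\psi]\to(\tilde\exists^{\mathrm{st}}y)[(\forall x\le^*y)\phi(x)\to\psi]$; $\mathsf{MAJ}^\omega$: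 $(\forall^{\mathrm{st}}x)(\exists^{\mathrm{st}}y)(x\le^*y)$. *)

(* Defs.v *)
From Stdlib Require Import List.
Import ListNotations.

Set Implicit Arguments.
Unset Strict Implicit.
Unset Printing Implicit Defensive.

(* Syntax is intrinsically typed and uses de Bruijn indices: a context lists the
   types of the free variables, the most recently bound one first.  Goedel's T
   is taken in its combinatory version, so terms contain no binders. *)

Inductive ty : Type :=
| N : ty
| Arr : ty -> ty -> ty.

Declare Scope ty_scope.
Delimit Scope ty_scope with ty.
Bind Scope ty_scope with ty.
Infix "~>" := Arr (at level 60, right associativity) : ty_scope.
Local Open Scope ty_scope.

Definition ty1 : ty := N ~> N.
Definition ty2 : ty := ty1 ~> N.

Definition ctx : Type := list ty.

Inductive var : ctx -> ty -> Type :=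
| VZ : forall (G : ctx) (s : ty), var (s :: G) s
| VS : forall (G : ctx) (s t : ty), var G t -> var (s :: G) t.
Arguments VZ {G s}.
Arguments VS {G s t} x.

Inductive tm (G : ctx) : ty -> Type :=
| Var : forall s, var G s -> tm G s
| App : forall s t, tm G (s ~> t) -> tm G s -> tm G t
| Zero : tm G N
| Succ : tm G (N ~> N)
| Pi : forall s t, tm G (s ~> t ~> s)
| Sigma : forall r s t, tm G ((r ~> s ~> t) ~> (r ~> s) ~> r ~> t)
| Rec : forall s, tm G (s ~> (s ~> N ~> s) ~> N ~> s).
Arguments App {G s t} f a.
Arguments Zero {G}.
Arguments Succ {G}.
Arguments Pi {G s t}.
Arguments Sigma {G r s t}.
Arguments Rec {G s}.

Declare Scope tm_scope.
Delimit Scope tm_scope with tm.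
Bind Scope tm_scope with tm.
Infix "@" := App (at level 40, left associativity) : tm_scope.
Arguments Var {G s} x.
Notation "'`0'" := (Var VZ) : tm_scope.
Notation "'`1'" := (Var (VS VZ)) : tm_scope.
Notation "'`2'" := (Var (VS (VS VZ))) : tm_scope.
Notation "'`3'" := (Var (VS (VS (VS VZ)))) : tm_scope.
Local Open Scope tm_scope.

Inductive fm (G : ctx) : Type :=
| Eq : tm G N -> tm G N -> fm G
| St : forall s, tm G s -> fm G
| Bot : fm G
| And : fm G -> fm G -> fm G
| Or : fm G -> fm G -> fm G
| Imp : fm G -> fm G -> fm G
| All : forall s, fm (s :: G) -> fm G
| Ex : forall s, fm (s :: G) -> fm G.
Arguments Eq {G} a b.
Arguments St {G s} a.
Arguments Bot {G}.
Arguments And {G} p q.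
Arguments Or {G} p q.
Arguments Imp {G} p q.
Arguments All {G} s p.
Arguments Ex {G} s p.

Declare Scope fm_scope.
Delimit Scope fm_scope with fm.
Bind Scope fm_scope with fm.
Infix "==" := Eq (at level 70, no associativity) : fm_scope.
Infix "&" := And (at level 76, right associativity) : fm_scope.
Infix "==>" := Imp (at level 78, right associativity) : fm_scope.
Local Open Scope fm_scope.

Definition Neg {G : ctx} (p : fm G) : fm G := p ==> Bot.

Definition sentence : Type := fm [].

Fixpoint internal {G : ctx} (p : fm G) : Prop :=
  match p with
  | Eq _ _ | Bot => True
  | St _ => False
  | And p q | Or p q | Imp p q => internal p /\ internal q
  | All _ p | Ex _ p => internal p
  end.

Fixpoint quantifier_free {G : ctx} (p : fm G) : Prop :=
  match p with
  | Eq _ _ | St _ | Bot => True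
  | And p q | Or p q | Imp p q => quantifier_free p /\ quantifier_free q
  | All _ _ | Ex _ _ => False
  end.

Definition scons {P : ty -> Type} {G : ctx} {s : ty} (a : P s)
    (f : forall t, var G t -> P t) (t : ty) (x : var (s :: G) t) : P t :=
  match x in var D t return
    match D with
    | [] => unit
    | s :: G => P s -> (forall t, var G t -> P t) -> P t
    end
  with
  | VZ => fun a _ => a
  | VS y => fun _ f => f _ y
  end a f.

Definition ren (G D : ctx) : Type := forall t, var G t -> var D t.
Definition sub (G D : ctx) : Type := forall t, var G t -> tm D t.

Definition shift {G : ctx} {s : ty} : ren G (s :: G) := fun _ x => VS x.

Definition up_ren {G D : ctx} {s : ty} (r : ren G D) : ren (s :: G) (s :: D) :=
  scons (P := var (s :: D)) VZ (fun t x => VS (r t x)).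

Fixpoint ren_tm {G D : ctx} (r : ren G D) {s : ty} (a : tm G s) : tm D s :=
  match a with
  | Var x => Var (r _ x)
  | App f a => ren_tm r f @ ren_tm r a
  | Zero => Zero
  | Succ => Succ
  | Pi => Pi
  | Sigma => Sigma
  | Rec => Rec
  end.

Definition wk {G : ctx} {s t : ty} (a : tm G t) : tm (s :: G) t :=
  ren_tm shift a.

Fixpoint ren_fm {G D : ctx} (r : ren G D) (p : fm G) : fm D :=
  match p with
  | Eq a b => ren_tm r a == ren_tm r b
  | St a => St (ren_tm r a)
  | Bot => Bot
  | And p q => ren_fm r p & ren_fm r q
  | Or p q => Or (ren_fm r p) (ren_fm r q)
  | Imp p q => ren_fm r p ==> ren_fm r q
  | All s p => All s (ren_fm (up_ren r) p)
  | Ex s p => Ex s (ren_fm (up_ren r) p)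
  end.

Definition wk_fm {G : ctx} {s : ty} (p : fm G) : fm (s :: G) := ren_fm shift p.

(* Weakening below the most recent variable, and below the two most recent. *)
Definition wk_fm1 {G : ctx} {s r : ty} (p : fm (r :: G)) : fm (r :: s :: G) :=
  ren_fm (up_ren shift) p.
Definition wk_fm2 {G : ctx} {s r1 r2 : ty} (p : fm (r2 :: r1 :: G)) :
    fm (r2 :: r1 :: s :: G) :=
  ren_fm (up_ren (up_ren shift)) p.

Definition up_sub {G D : ctx} {s : ty} (e : sub G D) : sub (s :: G) (s :: D) :=
  scons (P := tm (s :: D)) (Var VZ) (fun t x => wk (e t x)).

Fixpoint sub_tm {G D : ctx} (e : sub G D) {s : ty} (a : tm G s) : tm D s :=
  match a with
  | Var x => e _ x
  | App f a => sub_tm e f @ sub_tm e a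
  | Zero => Zero
  | Succ => Succ
  | Pi => Pi
  | Sigma => Sigma
  | Rec => Rec
  end.

Fixpoint sub_fm {G D : ctx} (e : sub G D) (p : fm G) : fm D :=
  match p with
  | Eq a b => sub_tm e a == sub_tm e b
  | St a => St (sub_tm e a)
  | Bot => Bot
  | And p q => sub_fm e p & sub_fm e q
  | Or p q => Or (sub_fm e p) (sub_fm e q)
  | Imp p q => sub_fm e p ==> sub_fm e q
  | All s p => All s (sub_fm (up_sub e) p)
  | Ex s p => Ex s (sub_fm (up_sub e) p)
  end.

Definition inst {G : ctx} {s : ty} (p : fm (s :: G)) (a : tm G s) : fm G :=
  sub_fm (scons (P := tm G) a (fun t x => Var x)) p.

(* p(n) becomes p(n+1), in the same context *)
Definition inst_succ {G : ctx} (p : fm (N :: G)) : fm (N :: G) :=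
  sub_fm (scons (P := tm (N :: G)) (Succ @ `0) (fun t x => Var (VS x))) p.

Definition no_var {D : ctx} : ren [] D :=
  fun t (x : var [] t) =>
    match x in var G t return
      match G with [] => var D t | _ :: _ => unit end
    with VZ | VS _ => tt end.

Definition lift {G : ctx} (p : sentence) : fm G := ren_fm no_var p.

Definition theory : Type := sentence -> Prop.

(* [prov T H p] : p is derivable from the axioms T and the hypotheses H, all
   free variables being declared in the context G. *)
Inductive prov (T : theory) : forall G : ctx, list (fm G) -> fm G -> Prop :=
| p_ax G H p : T p -> prov T (G := G) H (lift p)
| p_hyp G H p : In p H -> prov T (G := G) H p
| p_botE G H p : prov T H Bot -> prov T (G := G) H p
| p_andI G H p q : prov T H p -> prov T H q -> prov T (G := G) H (p & q)
| p_andE1 G H p q : prov T H (p & q) -> prov T (G := G) H p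
| p_andE2 G H p q : prov T H (p & q) -> prov T (G := G) H q
| p_orI1 G H p q : prov T H p -> prov T (G := G) H (Or p q)
| p_orI2 G H p q : prov T H q -> prov T (G := G) H (Or p q)
| p_orE G H p q r : prov T H (Or p q) ->
    prov T (p :: H) r -> prov T (q :: H) r -> prov T (G := G) H r
| p_impI G H p q : prov T (p :: H) q -> prov T (G := G) H (p ==> q)
| p_impE G H p q : prov T H (p ==> q) -> prov T H p -> prov T (G := G) H q
| p_allI G H s (p : fm (s :: G)) :
    prov T (map wk_fm H) p -> prov T H (All s p)
| p_allE G H s (p : fm (s :: G)) a : prov T H (All s p) -> prov T H (inst p a)
| p_exI G H s (p : fm (s :: G)) a : prov T H (inst p a) -> prov T H (Ex s p)
| p_exE G H s (p : fm (s :: G)) q :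
    prov T H (Ex s p) -> prov T (p :: map wk_fm H) (wk_fm q) -> prov T H q.

Definition inconsistent (T : theory) : Prop := prov T (G := []) [] Bot.

Definition union (T U : theory) : theory := fun p => T p \/ U p.
Infix "+++" := union (at level 50, left associativity).

Fixpoint closure (G : ctx) : fm G -> sentence :=
  match G with
  | [] => fun p => p
  | s :: G => fun p => closure (All s p)
  end.
Arguments closure {G} p.

(* Bracket abstraction. *)

Fixpoint Lam {G : ctx} {s t : ty} (a : tm (s :: G) t) : tm G (s ~> t) :=
  match a in tm _ t return tm G (s ~> t) with
  | Var x =>
      scons (P := fun t => tm G (s ~> t))
        (Sigma @ Pi @ @Pi G s s) (fun t y => Pi @ Var y) x
  | App f a => Sigma @ Lam f @ Lam a
  | Zero => Pi @ Zero
  | Succ => Pi @ Succ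
  | Pi => Pi @ Pi
  | Sigma => Pi @ Sigma
  | Rec => Pi @ Rec
  end.

Definition pred_tm {G : ctx} : tm G (N ~> N) := Rec @ Zero @ Lam (Lam `0).

Definition monus {G : ctx} : tm G (N ~> N ~> N) :=
  Lam (Rec @ `0 @ Lam (Lam (pred_tm @ `1))).

Definition add {G : ctx} : tm G (N ~> N ~> N) :=
  Lam (Rec @ `0 @ Lam (Lam (Succ @ `1))).

(* The recursor satisfies Rec x f 0 = x and Rec x f (n+1) = f (Rec x f n) n;
   hence tri n = 0 + 1 + ... + n *)
Definition tri {G : ctx} : tm G (N ~> N) :=
  Rec @ Zero @ Lam (Lam (add @ `1 @ (Succ @ `0))).

(* Cantor's pairing function *)
Definition pair {G : ctx} : tm G (N ~> N ~> N) :=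
  Lam (Lam (add @ (tri @ (add @ `1 @ `0)) @ `0)).

(* The number coding <f(0),...,f(n-1)>, where the empty sequence has code 0 and
   the extension of a sequence with code c by k has code 1 + pair(c,k). *)
Definition bar {G : ctx} : tm G (ty1 ~> N ~> N) :=
  Lam (Rec @ Zero @ Lam (Lam (Succ @ (pair @ `1 @ (`2 @ `0))))).

Definition one_fun {G : ctx} : tm G ty1 := Pi @ (Succ @ Zero).

Fixpoint eqt {G : ctx} {s : ty} : tm G s -> tm G s -> fm G :=
  match s with
  | N => fun a b => a == b
  | r ~> t => fun a b => All r (eqt (wk a @ `0) (wk b @ `0))
  end.

Fixpoint le {G : ctx} {s : ty} : tm G s -> tm G s -> fm G :=
  match s with
  | N => fun a b => monus @ a @ b == Zero
  | r ~> t => fun a b => All r (le (wk a @ `0) (wk b @ `0))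
  end.

Fixpoint maj {G : ctx} {s : ty} : tm G s -> tm G s -> fm G :=
  match s with
  | N => fun a b => le a b
  | r ~> t => fun a b =>
      All r (All r (maj `1 `0 ==>
        maj (wk (wk a) @ `1) (wk (wk b) @ `0) &
        maj (wk (wk b) @ `1) (wk (wk b) @ `0)))
  end.

Definition monotone {G : ctx} {s : ty} (a : tm G s) : fm G := maj a a.

(* In the names, M stands for monotone and Maj for majorized by a. *)
Section Quantifiers.
Context {G : ctx}.

Definition AllSt {s : ty} (p : fm (s :: G)) : fm G := All s (St `0 ==> p).
Definition ExSt {s : ty} (p : fm (s :: G)) : fm G := Ex s (St `0 & p).
Definition AllMSt {s : ty} (p : fm (s :: G)) : fm G :=
  All s (St `0 ==> monotone `0 ==> p).
Definition ExMSt {s : ty} (p : fm (s :: G)) : fm G :=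
  Ex s (St `0 & monotone `0 & p).
Definition AllMaj {s : ty} (a : tm G s) (p : fm (s :: G)) : fm G :=
  All s (maj `0 (wk a) ==> p).
Definition ExMaj {s : ty} (a : tm G s) (p : fm (s :: G)) : fm G :=
  Ex s (maj `0 (wk a) & p).
Definition ExMMaj {s : ty} (a : tm G s) (p : fm (s :: G)) : fm G :=
  Ex s (monotone `0 & maj `0 (wk a) & p).

End Quantifiers.

(* Schemata are given by the universal closures of their instances.  Induction
   for formulas containing St is available only in the external form of DG: with
   it in the present form, every number would be provably standard. *)

Inductive EHA : theory :=
| eq_refl_ax : EHA (All N (`0 == `0))
| eq_sym_ax : EHA (All N (All N (`1 == `0 ==> `0 == `1)))
| eq_trans_ax :
    EHA (All N (All N (All N (`2 == `1 ==> `1 == `0 ==> `2 == `0))))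
| succ_neq0_ax : EHA (All N (Neg (Succ @ `0 == Zero)))
| succ_inj_ax : EHA (All N (All N (Succ @ `1 == Succ @ `0 ==> `1 == `0)))
| induction_ax G (p : fm (N :: G)) : internal p ->
    EHA (closure (inst p Zero & All N (p ==> inst_succ p) ==> All N p))
| Pi_ax s t : EHA (All s (All t (eqt (Pi @ `1 @ `0) `1)))
| Sigma_ax r s t :
    EHA (All (r ~> s ~> t) (All (r ~> s) (All r
      (eqt (Sigma @ `2 @ `1 @ `0) (`2 @ `0 @ (`1 @ `0))))))
| Rec0_ax s : EHA (All s (All (s ~> N ~> s) (eqt (Rec @ `1 @ `0 @ Zero) `1)))
| RecS_ax s :
    EHA (All s (All (s ~> N ~> s) (All N
      (eqt (Rec @ `2 @ `1 @ (Succ @ `0)) (`1 @ (Rec @ `2 @ `1 @ `0) @ `0)))))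
| ext_ax r t :
    EHA (All (r ~> t) (All r (All r
      (eqt `1 `0 ==> eqt (`2 @ `1) (`2 @ `0))))).

Inductive DG : theory :=
| EHA_ax p : EHA p -> DG p
| st_eq_ax s : DG (All s (All s (eqt `1 `0 ==> St `1 ==> St `0)))
| st_maj_ax s : DG (All s (All s (St `0 ==> maj `1 `0 ==> St `1)))
| st_closed_ax s (a : tm [] s) : DG (St a)
| st_app_ax s t : DG (All (s ~> t) (All s (St `1 ==> St `0 ==> St (`1 @ `0))))
| st_induction_ax G (P : fm (N :: G)) :
    DG (closure (inst P Zero & AllSt (P ==> inst_succ P) ==> AllSt P))
| mAC_ax G s t (P : fm (t :: s :: G)) :
    DG (closure (AllMSt (ExMSt P) ==>
      ExMSt (s := s ~> t) (AllMSt (s := s) (ExMaj (`1 @ `0) (wk_fm2 P)))))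
| R_ax G s t (P : fm (t :: s :: G)) :
    DG (closure (All s (ExSt P) ==> ExMSt (All s (ExMaj `1 (wk_fm2 P)))))
| I_ax G s t (p : fm (t :: s :: G)) : internal p ->
    DG (closure (AllMSt (Ex s (AllMaj `1 (wk_fm2 p))) ==> Ex s (AllSt p)))
| IP_ax G s t (p : fm (s :: G)) (P : fm (t :: G)) : internal p ->
    DG (closure ((AllMSt p ==> ExMSt P) ==>
      ExMSt (s := t) (AllMSt (wk_fm1 p) ==> ExMMaj `0 (wk_fm1 P))))
| M_ax G s (p : fm (s :: G)) (q : fm G) : internal p -> internal q ->
    DG (closure ((AllMSt p ==> q) ==>
      ExMSt (s := s) (AllMaj `0 (wk_fm1 p) ==> wk_fm q)))
| MAJ_ax s : DG (AllSt (ExSt (s := s) (maj `1 `0))).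

(* Bounded number quantifiers are exempt from relativisation.  None has to be
   recognised here: the order on numbers and finite initial segments are
   expressed by terms, so the principles below contain no such quantifier. *)
Fixpoint rel {G : ctx} (p : fm G) : fm G :=
  match p with
  | Eq a b => a == b
  | St a => St a
  | Bot => Bot
  | And p q => rel p & rel q
  | Or p q => Or (rel p) (rel q)
  | Imp p q => rel p ==> rel q
  | All s p => AllSt (rel p)
  | Ex s p => ExSt (rel p)
  end.

Definition relativised (T : theory) : theory :=
  fun p => exists q : sentence, T q /\ p = rel q.

Inductive BCT_C : theory :=
| BCT_C_ax : BCT_C
    (All ty2 (All ty1 (le `0 one_fun ==> Ex N (All ty1 (le `0 one_fun ==>
      bar @ `2 @ `1 == bar @ `0 @ `1 ==> `3 @ `2 == `3 @ `0))))).

(* In the conclusion, the variables are b, m, n, a from the innermost outwards;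
   [WC_ren] turns A(a,n) into A(b,m). *)
Definition WC_ren {G : ctx} :
    ren (N :: ty1 :: G) (ty1 :: N :: N :: ty1 :: G) :=
  scons (P := var (ty1 :: N :: N :: ty1 :: G)) (VS VZ)
    (scons (P := var (ty1 :: N :: N :: ty1 :: G)) VZ
      (fun t x => VS (VS (VS (VS x))))).

(* The parameters of A are those declared in G.  An instance is the universal
   closure over its parameters, so that relativisation makes them standard. *)
Inductive WC_N0 : theory :=
| WC_N0_ax G (A : fm (N :: ty1 :: G)) : quantifier_free A -> internal A ->
    WC_N0 (closure
      (All ty1 (Ex N A) ==>
       All ty1 (Ex N (Ex N (All ty1
         (bar @ `3 @ `2 == bar @ `0 @ `2 ==> ren_fm WC_ren A)))))).

Inductive SE : theory :=
| SE_ax : SE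
    (All ty2 (All ty1 (All ty1
      (Neg (`2 @ `1 == `2 @ `0) ==> Ex N (Neg (`2 @ `0 == `1 @ `0)))))).

(* Main.v *)
(* Idealisation gives a number x above all standard numbers.  Let
   g(n) = sg(n - x) and Y(h) = sg(h(x + 1)), with truncated subtraction; these
   are [threshold @ x] and [probe @ x].  Both are majorised by the constant 1,
   hence standard, although x is not.  At every standard number g agrees with
   the zero function 0, and by external induction so do the codes of their
   standard initial segments; yet Y(0) = 0 and Y(g) = 1.  So g and 0 cannot be
   told apart by standard means while the standard Y separates them, which
   contradicts each of the three relativised principles ([WC_N0] being applied
   to the formula Y(a) = n). *)
From Stdlib Require Import List.
Import ListNotations.
Require Import Defs.

Set Implicit Arguments.
Unset Strict Implicit.
Unset Printing Implicit Defensive.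

Local Open Scope ty_scope.
Local Open Scope tm_scope.
Local Open Scope fm_scope.

(** * Renaming and substitution on terms and equations *)

Lemma ren_tm_ren (G D E : ctx) (r : ren G D) (q : ren D E) s (a : tm G s) :
  ren_tm q (ren_tm r a) = ren_tm (fun t x => q t (r t x)) a.
Proof. induction a; simpl; congruence. Qed.

Lemma sub_tm_ren (G D E : ctx) (r : ren G D) (e : sub D E) s (a : tm G s) :
  sub_tm e (ren_tm r a) = sub_tm (fun t x => e t (r t x)) a.
Proof. induction a; simpl; congruence. Qed.

Lemma ren_tm_sub (G D E : ctx) (e : sub G D) (r : ren D E) s (a : tm G s) :
  ren_tm r (sub_tm e a) = sub_tm (fun t x => ren_tm r (e t x)) a.
Proof. induction a; simpl; congruence. Qed.

Lemma sub_tm_Var (G : ctx) s (a : tm G s) : sub_tm (fun t x => Var x) a = a.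
Proof. induction a; simpl; congruence. Qed.

Lemma sub_tm_wk (G : ctx) s t (b : tm G s) (a : tm G t) :
  sub_tm (scons (P := tm G) b (fun _ x => Var x)) (ren_tm shift a) = a.
Proof. rewrite sub_tm_ren; exact (sub_tm_Var a). Qed.

Lemma ren_tm_up_wk (G D : ctx) (r : ren G D) s t (a : tm G t) :
  ren_tm (up_ren (s := s) r) (ren_tm shift a) = ren_tm shift (ren_tm r a).
Proof. rewrite !ren_tm_ren; reflexivity. Qed.

Lemma sub_tm_up_wk (G D : ctx) (e : sub G D) s t (a : tm G t) :
  sub_tm (up_sub (s := s) e) (ren_tm shift a) = ren_tm shift (sub_tm e a).
Proof. rewrite sub_tm_ren, ren_tm_sub; reflexivity. Qed.

Lemma ren_fm_eqt s : forall (G D : ctx) (r : ren G D) (a b : tm G s),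
  ren_fm r (eqt a b) = eqt (ren_tm r a) (ren_tm r b).
Proof.
  induction s as [|s _ t IH]; intros; [reflexivity|].
  simpl; rewrite IH; simpl; unfold wk; rewrite !ren_tm_up_wk; reflexivity.
Qed.

Lemma sub_fm_eqt s : forall (G D : ctx) (e : sub G D) (a b : tm G s),
  sub_fm e (eqt a b) = eqt (sub_tm e a) (sub_tm e b).
Proof.
  induction s as [|s _ t IH]; intros; [reflexivity|].
  simpl; rewrite IH; simpl; unfold wk; rewrite !sub_tm_up_wk; reflexivity.
Qed.

(** The context of [x] is a cons and not a variable, so the case analysis generalises it: the return
    clause matches on the context, and [P] is quantified inside it because its type mentions [G] and
    [s]. *)
Lemma var_cons_ind (G : ctx) s (P : forall t, var (s :: G) t -> Prop) :
  P s VZ -> (forall t (y : var G t), P t (VS y)) -> forall t x, P t x.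
Proof.
  intros HZ HS t x; revert P HZ HS.
  refine (match x in var D t return
    match D return var D t -> Prop with
    | [] => fun _ => True
    | s :: G => fun x => forall P : forall t, var (s :: G) t -> Prop,
        P s VZ -> (forall t y, P t (VS y)) -> P t x
    end x with VZ => _ | VS y => _ end); auto.
Qed.

(** * Closed terms in arbitrary contexts *)

Lemma sub_tm_closed (G : ctx) (e : sub [] G) s (a : tm [] s) :
  sub_tm e a = ren_tm no_var a.
Proof.
  induction a as [t x| | | | | |]; simpl; try congruence.
  exact (match x in var D t return
    match D return var D t -> Prop with
    | [] => fun x => forall e : sub [] G, e t x = Var (no_var x)
    | _ :: _ => fun _ => True
    end x with VZ | VS _ => I end e).
Qed.

Lemma ren_tm_Var (G D : ctx) (r : ren G D) s (a : tm G s) :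
  ren_tm r a = sub_tm (fun t x => Var (r t x)) a.
Proof. induction a; simpl; congruence. Qed.

(** Bracket abstraction inspects whether a subterm is a variable. A renaming keeps variables
    variables, so the two commute literally, which fails for substitutions. *)
Lemma ren_tm_Lam (G D : ctx) (r : ren G D) s t (a : tm (s :: G) t) :
  ren_tm r (Lam a) = Lam (ren_tm (up_ren r) a).
Proof.
  induction a as [t x|t u f IHf a IHa| | | | |]; simpl; try congruence.
  revert t x; apply var_cons_ind; reflexivity.
Qed.

(** A closed term written uniformly in the context is formally a different term in each context.
    Requiring all of them to be weakenings of a single one makes them invariant under renaming and
    substitution. *)
Definition closed_family s (c : forall G, tm G s) : Prop :=
  forall G, c G = ren_tm no_var (c []).

Lemma closed_family_sub s (c : forall G, tm G s) (hc : closed_family c)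
    (G D : ctx) (e : sub G D) :
  sub_tm e (c G) = c D.
Proof. rewrite (hc G), (hc D), sub_tm_ren; apply sub_tm_closed. Qed.

Lemma closed_family_ren s (c : forall G, tm G s) (hc : closed_family c)
    (G D : ctx) (r : ren G D) :
  ren_tm r (c G) = c D.
Proof. rewrite ren_tm_Var; apply closed_family_sub, hc. Qed.

Local Arguments Lam : simpl never.
Local Arguments pred_tm : simpl never.
Local Arguments monus : simpl never.
Local Arguments add : simpl never.
Local Arguments tri : simpl never.
Local Arguments pair : simpl never.
Local Arguments bar : simpl never.

Lemma pred_closed : closed_family (@pred_tm).
Proof. intros G; reflexivity. Qed.

Lemma add_closed : closed_family (@add).
Proof.
  intros G; unfold add; repeat (rewrite ren_tm_Lam; cbn [ren_tm]); reflexivity.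
Qed.

Lemma monus_closed : closed_family (@monus).
Proof.
  intros G; unfold monus; repeat (rewrite ren_tm_Lam; cbn [ren_tm]).
  rewrite (closed_family_ren pred_closed); reflexivity.
Qed.

Lemma tri_closed : closed_family (@tri).
Proof.
  intros G; unfold tri; cbn [ren_tm]; repeat (rewrite ren_tm_Lam; cbn [ren_tm]).
  rewrite (closed_family_ren add_closed); reflexivity.
Qed.

Lemma pair_closed : closed_family (@pair).
Proof.
  intros G; unfold pair; repeat (rewrite ren_tm_Lam; cbn [ren_tm]).
  rewrite !(closed_family_ren add_closed), (closed_family_ren tri_closed).
  reflexivity.
Qed.

Lemma bar_closed : closed_family (@bar).
Proof.
  intros G; unfold bar; repeat (rewrite ren_tm_Lam; cbn [ren_tm]).
  rewrite (closed_family_ren pair_closed); reflexivity.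
Qed.

(** Cutting values down to at most 1 is what gives [threshold @ x] and [probe @ x] a standard
    majorant, whatever [x] is. *)
Definition sg {G : ctx} : tm G ty1 := Rec @ Zero @ Lam (Lam (Succ @ Zero)).
Definition threshold {G : ctx} : tm G (N ~> ty1) :=
  Lam (Lam (sg @ (monus @ `0 @ `1))).
Definition probe {G : ctx} : tm G (N ~> ty2) :=
  Lam (Lam (sg @ (`0 @ (Succ @ `1)))).

Local Arguments sg : simpl never.
Local Arguments threshold : simpl never.
Local Arguments probe : simpl never.

Lemma sg_closed : closed_family (@sg).
Proof. intros G; reflexivity. Qed.

Lemma threshold_closed : closed_family (@threshold).
Proof.
  intros G; unfold threshold; repeat (rewrite ren_tm_Lam; cbn [ren_tm]).
  rewrite (closed_family_ren sg_closed), (closed_family_ren monus_closed).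
  reflexivity.
Qed.

Lemma probe_closed : closed_family (@probe).
Proof.
  intros G; unfold probe; repeat (rewrite ren_tm_Lam; cbn [ren_tm]).
  rewrite (closed_family_ren sg_closed); reflexivity.
Qed.

(** * Derived rules and the normalisation of substitution instances *)

(** A substitution instance rarely has the wanted shape on the nose; the separate equation lets the
    shape be chosen first and checked afterwards. *)
Lemma allE (T : theory) (G : ctx) H s (p : fm (s :: G)) a q :
  prov T H (All s p) -> inst p a = q -> prov T H q.
Proof. intros h <-; exact (p_allE a h). Qed.

Lemma exI (T : theory) (G : ctx) H s (p : fm (s :: G)) a q :
  prov T H q -> inst p a = q -> prov T H (Ex s p).
Proof. intros h <-; exact (p_exI h). Qed.

Lemma ax (T : theory) (G : ctx) H p q : T p -> lift p = q -> prov T (G := G) H q.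
Proof. intros h <-; apply p_ax; exact h. Qed.

Lemma cut (T : theory) (G : ctx) H p q :
  prov T H p -> prov T (p :: H) q -> prov T (G := G) H q.
Proof. intros hp hq; exact (p_impE (p_impI hq) hp). Qed.

Ltac hyp := apply p_hyp; repeat (first [left; reflexivity | right]).

Local Arguments wk {G s t} a : simpl never.

Ltac inst_eqt :=
  unfold inst, lift; cbn; rewrite ?ren_fm_eqt, ?sub_fm_eqt; cbn; unfold wk;
  rewrite ?sub_tm_up_wk, ?sub_tm_wk; reflexivity.

Definition empty_sub {G : ctx} : sub [] G := fun t x => Var (no_var x).

Ltac inst_closed :=
  unfold inst, inst_succ, lift, wk_fm, wk_fm1, wk_fm2, AllSt, ExSt, AllMSt, ExMSt,
    AllMaj, ExMaj, ExMMaj, Neg;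
  repeat (progress (cbn; unfold wk));
  repeat (first
    [ match goal with hc : closed_family _ |- _ =>
        first [ rewrite (closed_family_ren hc) | rewrite (closed_family_sub hc) ] end
    | rewrite (closed_family_ren monus_closed) | rewrite (closed_family_sub monus_closed)
    | rewrite (closed_family_ren threshold_closed)
    | rewrite (closed_family_sub threshold_closed)
    | rewrite (closed_family_ren sg_closed) | rewrite (closed_family_sub sg_closed)
    | rewrite (closed_family_ren probe_closed)
    | rewrite (closed_family_sub probe_closed) ]);
  rewrite ?sub_tm_up_wk, ?sub_tm_wk; reflexivity.

(* The parameter [c] stands for [bar], which is kept abstract because conversion
   tests that unfold it explode. *)
Definition separates {G : ctx} (c : forall G, tm G (ty1 ~> N ~> N))
    (Y : tm G ty2) (f g : tm G ty1) : fm G :=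
  St Y & St f & St g
  & AllSt (le (wk f @ `0) (one_fun @ `0)) & AllSt (le (wk g @ `0) (one_fun @ `0))
  & AllSt (wk f @ `0 == wk g @ `0)
  & AllSt (c _ @ wk f @ `0 == c _ @ wk g @ `0)
  & Neg (Y @ f == Y @ g).

Lemma ren_fm_separates (G D : ctx) (r : ren G D) c Y f g :
  closed_family c -> ren_fm r (separates c Y f g) =
  separates c (ren_tm r Y) (ren_tm r f) (ren_tm r g).
Proof.
  intros hc; unfold separates, AllSt, Neg; cbn; unfold wk.
  rewrite ?(closed_family_ren monus_closed), !(closed_family_ren hc), !ren_tm_up_wk.
  reflexivity.
Qed.

Lemma sub_fm_separates (G D : ctx) (e : sub G D) c Y f g :
  closed_family c -> sub_fm e (separates c Y f g) =
  separates c (sub_tm e Y) (sub_tm e f) (sub_tm e g).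
Proof.
  intros hc; unfold separates, AllSt, Neg; cbn; unfold wk.
  rewrite ?(closed_family_sub monus_closed), !(closed_family_sub hc), !sub_tm_up_wk.
  reflexivity.
Qed.

(** * Derivations in an arbitrary extension of DG: equality at all types *)

Section ExtensionsOfDG.
Variable T : theory.
Hypothesis DG_T : forall p, DG p -> T p.

Lemma EHA_T p : EHA p -> T p.
Proof. intros h; apply DG_T, EHA_ax, h. Qed.

Lemma eq_sym G H (a b : tm G N) : prov T H (a == b) -> prov T H (b == a).
Proof.
  intros h; refine (p_impE _ h).
  eapply allE with (a := b); [eapply allE with (a := a)|].
  - eapply ax; [apply EHA_T, eq_sym_ax | reflexivity].
  - reflexivity.
  - inst_eqt.
Qed.

Lemma eq_trans G H (a b c : tm G N) :
  prov T H (a == b) -> prov T H (b == c) -> prov T H (a == c).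
Proof.
  intros h h'; refine (p_impE (p_impE _ h) h').
  eapply allE with (a := c);
    [eapply allE with (a := b); [eapply allE with (a := a)|]|].
  - eapply ax; [apply EHA_T, eq_trans_ax | reflexivity].
  - reflexivity.
  - reflexivity.
  - inst_eqt.
Qed.

Lemma eqt_refl s : forall G H (a : tm G s), prov T H (eqt a a).
Proof.
  induction s as [|s _ t IH]; intros.
  - eapply allE; [eapply ax; [apply EHA_T, eq_refl_ax | reflexivity] | reflexivity].
  - apply p_allI, IH.
Qed.

Lemma eqt_app1 G H s t (f g : tm G (s ~> t)) (a : tm G s) :
  prov T H (eqt f g) -> prov T H (eqt (f @ a) (g @ a)).
Proof.
  intros h; apply (allE (a := a) h).
  unfold inst; rewrite sub_fm_eqt; cbn; unfold wk; rewrite !sub_tm_wk; reflexivity.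
Qed.

(* Symmetry and transitivity are first shown for hypotheses, which the quantifier
   rule weakens, so that no weakening of derivations is needed. *)
Lemma eqt_sym_hyp s : forall G H (a b : tm G s),
  In (eqt a b) H -> prov T H (eqt b a).
Proof.
  induction s as [|s _ t IH]; intros G H a b h.
  - apply eq_sym, p_hyp, h.
  - apply p_allI.
    assert (h1 : prov T (map wk_fm H) (eqt (wk (s := s) a) (wk b))).
    { apply p_hyp; unfold wk; rewrite <- ren_fm_eqt; exact (in_map (wk_fm (s := s)) _ _ h). }
    refine (cut (eqt_app1 `0 h1) _); apply IH; left; reflexivity.
Qed.

Lemma eqt_sym G H s (a b : tm G s) : prov T H (eqt a b) -> prov T H (eqt b a).
Proof. intros h; apply (cut h), eqt_sym_hyp; left; reflexivity. Qed.

Lemma eqt_trans_hyp s : forall G H (a b c : tm G s),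
  In (eqt a b) H -> In (eqt b c) H -> prov T H (eqt a c).
Proof.
  induction s as [|s _ t IH]; intros G H a b c h h'.
  - exact (eq_trans (p_hyp _ h) (p_hyp _ h')).
  - apply p_allI.
    assert (h1 : prov T (map wk_fm H) (eqt (wk (s := s) a) (wk b))).
    { apply p_hyp; unfold wk; rewrite <- ren_fm_eqt; exact (in_map (wk_fm (s := s)) _ _ h). }
    assert (h2 : prov T (map wk_fm H) (eqt (wk (s := s) b) (wk c))).
    { apply p_hyp; unfold wk; rewrite <- ren_fm_eqt; exact (in_map (wk_fm (s := s)) _ _ h'). }
    apply (eqt_app1 `0) in h1, h2.
    refine (p_impE (p_impE (p_impI (p_impI _)) h1) h2).
    apply (IH _ _ _ (wk b @ `0)); simpl; auto.
Qed.

Lemma eqt_trans G H s (b a c : tm G s) :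
  prov T H (eqt a b) -> prov T H (eqt b c) -> prov T H (eqt a c).
Proof.
  intros h1 h2; refine (p_impE (p_impE (p_impI (p_impI _)) h1) h2).
  apply (eqt_trans_hyp (b := b)); simpl; auto.
Qed.

(** Congruence in the function is built into [eqt]; congruence in the argument is the extensionality
    axiom. *)
Lemma eqt_app2 G H s t (f : tm G (s ~> t)) (a b : tm G s) :
  prov T H (eqt a b) -> prov T H (eqt (f @ a) (f @ b)).
Proof.
  intros h; refine (p_impE _ h).
  eapply allE with (a := b);
    [eapply allE with (a := a); [eapply allE with (a := f)|]|].
  - eapply ax; [apply EHA_T, (ext_ax s t) | reflexivity].
  - reflexivity.
  - reflexivity.
  - inst_eqt.
Qed.

Lemma eqt_app G H s t (f g : tm G (s ~> t)) (a b : tm G s) :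
  prov T H (eqt f g) -> prov T H (eqt a b) -> prov T H (eqt (f @ a) (g @ b)).
Proof.
  intros h h'; exact (eqt_trans (eqt_app1 a h) (eqt_app2 g h')).
Qed.

Lemma eqt_Pi G H s t (a : tm G s) (b : tm G t) : prov T H (eqt (Pi @ a @ b) a).
Proof.
  eapply allE with (a := b); [eapply allE with (a := a)|].
  - eapply ax; [apply EHA_T, (Pi_ax s t) | reflexivity].
  - reflexivity.
  - inst_eqt.
Qed.

Lemma eqt_Sigma G H r s t (a : tm G (r ~> s ~> t)) (b : tm G (r ~> s)) c :
  prov T H (eqt (Sigma @ a @ b @ c) (a @ c @ (b @ c))).
Proof.
  eapply allE with (a := c);
    [eapply allE with (a := b); [eapply allE with (a := a)|]|].
  - eapply ax; [apply EHA_T, (Sigma_ax r s t) | reflexivity].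
  - reflexivity.
  - reflexivity.
  - inst_eqt.
Qed.

Lemma eqt_Rec0 G H s (a : tm G s) f : prov T H (eqt (Rec @ a @ f @ Zero) a).
Proof.
  eapply allE with (a := f); [eapply allE with (a := a)|].
  - eapply ax; [apply EHA_T, (Rec0_ax s) | reflexivity].
  - reflexivity.
  - inst_eqt.
Qed.

Lemma eqt_RecS G H s (a : tm G s) f n :
  prov T H (eqt (Rec @ a @ f @ (Succ @ n)) (f @ (Rec @ a @ f @ n) @ n)).
Proof.
  eapply allE with (a := n);
    [eapply allE with (a := f); [eapply allE with (a := a)|]|].
  - eapply ax; [apply EHA_T, (RecS_ax s) | reflexivity].
  - reflexivity.
  - reflexivity.
  - inst_eqt.
Qed.

(* The substitution [e] makes this applicable to nested abstractions, since
   [Lam] commutes with substitution only up to provable equality. *)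
Lemma eqt_beta G D H s t (e : sub G D) (a : tm (s :: G) t) (d : tm D s) :
  prov T H (eqt (sub_tm e (Lam a) @ d) (sub_tm (scons (P := tm D) d e) a)).
Proof.
  induction a as [t x|t u f IHf a IHa| | | | |]; try apply eqt_Pi.
  - revert t x; apply var_cons_ind; intros.
    + refine (eqt_trans (eqt_Sigma _ _ _ _) (eqt_Pi _ _ _)).
    + apply eqt_Pi.
  - exact (eqt_trans (eqt_Sigma _ _ _ _) (eqt_app IHf IHa)).
Qed.

(** The step of every recursor used here is a double abstraction, over the previous value and then
    over the index. Two beta steps therefore put the index for variable 0 and the previous value [z]
    for variable 1. *)
Lemma eqt_Rec_Lam2 G D H (e : sub G D) s (c : tm D s) (a : tm (N :: s :: G) s) n
    (z := Rec @ c @ sub_tm e (Lam (Lam a)) @ n) :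
  prov T H (eqt (Rec @ c @ sub_tm e (Lam (Lam a)) @ (Succ @ n))
    (sub_tm (scons (P := tm D) n (scons (P := tm D) z e)) a)).
Proof.
  refine (eqt_trans (eqt_RecS _ _ _ _) _).
  refine (eqt_trans (eqt_app1 _ (eqt_beta _ _ _ _)) _).
  apply eqt_beta.
Qed.

(** * Computation rules for arithmetic, sequence codes and the two witnesses *)

Lemma pred0 G H : prov T (G := G) H (pred_tm @ Zero == Zero).
Proof. exact (eqt_Rec0 (s := N) H _ _). Qed.

Lemma predS G H (n : tm G N) : prov T H (pred_tm @ (Succ @ n) == n).
Proof.
  exact (eqt_Rec_Lam2 H empty_sub Zero (`0 : tm [N; N] N) n).
Qed.

Lemma monus_unfold G H (a : tm G N) :
  prov T H (eqt (monus @ a) (Rec @ a @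
    sub_tm (scons (P := tm G) a empty_sub) (Lam (Lam (pred_tm @ `1))))).
Proof.
  exact (eqt_beta H empty_sub (Rec @ `0 @ Lam (Lam (pred_tm @ `1))) a).
Qed.

Lemma monus0 G H (a : tm G N) : prov T H (monus @ a @ Zero == a).
Proof.
  exact (eqt_trans (eqt_app1 _ (monus_unfold H a)) (eqt_Rec0 (s := N) H _ _)).
Qed.

Lemma monusS G H (a b : tm G N) :
  prov T H (monus @ a @ (Succ @ b) == pred_tm @ (monus @ a @ b)).
Proof.
  refine (eqt_trans (eqt_app1 _ (monus_unfold H a)) _).
  refine (eqt_trans _ (eqt_app2 pred_tm (eqt_sym (eqt_app1 _ (monus_unfold H a))))).
  exact (eqt_Rec_Lam2 H (scons (P := tm G) a empty_sub) a
    (pred_tm @ `1 : tm [N; N; N] N) b).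
Qed.

Lemma bar_unfold G H (f : tm G ty1) :
  prov T H (eqt (bar @ f) (Rec @ Zero @ sub_tm (scons (P := tm G) f empty_sub)
    (Lam (Lam (Succ @ (pair @ `1 @ (`2 @ `0))))))).
Proof.
  (* This presents [bar] as a substituted abstraction, the form on which [eqt_beta] acts. *)
  rewrite <- (closed_family_sub bar_closed empty_sub).
  refine (eqt_beta H empty_sub _ f).
Qed.

Lemma bar0 G H (f : tm G ty1) : prov T H (bar @ f @ Zero == Zero).
Proof.
  exact (eqt_trans (eqt_app1 _ (bar_unfold H f)) (eqt_Rec0 (s := N) H _ _)).
Qed.

Lemma barS G H (f : tm G ty1) n :
  prov T H (bar @ f @ (Succ @ n) == Succ @ (pair @ (bar @ f @ n) @ (f @ n))).
Proof.
  refine (eqt_trans (eqt_app1 _ (bar_unfold H f)) _).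
  refine (eqt_trans _ (eqt_app2 Succ
    (eqt_app1 _ (eqt_app2 pair (eqt_sym (eqt_app1 _ (bar_unfold H f))))))).
  exact (eqt_Rec_Lam2 H (scons (P := tm G) f empty_sub) Zero
    (Succ @ (pair @ `1 @ (`2 @ `0)) : tm [N; N; ty1] N) n).
Qed.

Lemma sg0 G H : prov T (G := G) H (sg @ Zero == Zero).
Proof. exact (eqt_Rec0 (s := N) H _ _). Qed.

Lemma sgS G H (n : tm G N) : prov T H (sg @ (Succ @ n) == Succ @ Zero).
Proof.
  exact (eqt_Rec_Lam2 H empty_sub Zero (Succ @ Zero : tm [N; N] N) n).
Qed.

Lemma threshold_app G H (x n : tm G N) :
  prov T H (threshold @ x @ n == sg @ (monus @ n @ x)).
Proof.
  rewrite <- (closed_family_sub threshold_closed empty_sub).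
  refine (eq_trans (eqt_app1 (t := N) _ (eqt_beta _ _ _ _)) _).
  refine (eq_trans (eqt_beta (t := N) _ _ _ _) _).
  cbn; rewrite (closed_family_sub sg_closed), (closed_family_sub monus_closed).
  exact (eqt_refl (s := N) _ _).
Qed.

Lemma probe_app G H (x : tm G N) (h : tm G ty1) :
  prov T H (probe @ x @ h == sg @ (h @ (Succ @ x))).
Proof.
  rewrite <- (closed_family_sub probe_closed empty_sub).
  refine (eq_trans (eqt_app1 (t := N) _ (eqt_beta _ _ _ _)) _).
  refine (eq_trans (eqt_beta (t := N) _ _ _ _) _).
  cbn; rewrite (closed_family_sub sg_closed).
  exact (eqt_refl (s := N) _ _).
Qed.

Lemma one_le_one G H : prov T (G := G) H (le (Succ @ Zero) (Succ @ Zero)).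
Proof.
  refine (eq_trans (monusS _ _ _) _).
  exact (eq_trans (eqt_app2 (t := N) pred_tm (monus0 _ _)) (predS _ _)).
Qed.

(** Induction serves as a case distinction: [sg] takes the value 0 or 1, and subtracting 1 is a
    single predecessor, which yields 0 in both cases. *)
Lemma sg_le_one G H (n : tm G N) : prov T H (le (sg @ n) (Succ @ Zero)).
Proof.
  apply allE with (p := le (sg @ `0) (Succ @ Zero)) (a := n); [|inst_closed].
  refine (p_impE _ _).
  - refine (ax _ (EHA_T (@induction_ax [] (le (sg @ `0) (Succ @ Zero)) I)) _).
    cbn [closure]; inst_closed.
  - apply p_andI; [|apply p_allI, p_impI].
    + refine (eq_trans (monusS _ _ _) _).
      refine (eq_trans (eqt_app2 (t := N) pred_tm (monus0 _ _)) _).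
      exact (eq_trans (eqt_app2 (t := N) pred_tm (sg0 _)) (pred0 _)).
    + refine (eq_trans (monusS _ _ _) _).
      refine (eq_trans (eqt_app2 (t := N) pred_tm (monus0 _ _)) _).
      exact (eq_trans (eqt_app2 (t := N) pred_tm (sgS _ _)) (predS _ _)).
Qed.

Lemma monus_SS G H (a b : tm G N) :
  prov T H (monus @ (Succ @ a) @ (Succ @ b) == monus @ a @ b).
Proof.
  (* Induction runs on the subtrahend, variable 0. The minuend is first generalised to variable 1,
     because the axiom is a closed sentence that quantifies over the parameters of the induction
     formula. *)
  pose (p := monus @ (Succ @ `1) @ (Succ @ `0) == monus @ `1 @ `0 : fm [N; N]).
  apply allE with (p := monus @ (Succ @ wk a) @ (Succ @ `0) == monus @ wk a @ `0)
    (a := b); [|inst_closed].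
  apply allE with (a := a)
    (p := All N (monus @ (Succ @ `1) @ (Succ @ `0) == monus @ `1 @ `0));
    [|inst_closed].
  apply p_allI; refine (p_impE _ _).
  - eapply allE with (a := `0);
      [refine (ax _ (EHA_T (@induction_ax [N] p I)) _); reflexivity|].
    inst_closed.
  - apply p_andI; [|apply p_allI, p_impI].
    + refine (eq_trans (monusS _ _ _) _).
      refine (eq_trans (eqt_app2 (t := N) pred_tm (monus0 _ _)) _).
      exact (eq_trans (predS _ _) (eq_sym (monus0 _ _))).
    + refine (eq_trans (monusS _ _ _) (eq_trans _ (eq_sym (monusS _ _ _)))).
      apply (eqt_app2 (s := N) (t := N)); hyp.
Qed.

(** This is the value of n - x at n = x + 1, the argument at which [probe @ x] evaluates
    [threshold @ x]. *)
Lemma monus_S_self G H (a : tm G N) :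
  prov T H (monus @ (Succ @ a) @ a == Succ @ Zero).
Proof.
  pose (p := monus @ (Succ @ `0) @ `0 == Succ @ Zero : fm [N]).
  apply allE with (p := monus @ (Succ @ `0) @ `0 == Succ @ Zero) (a := a);
    [|inst_closed].
  refine (p_impE _ _).
  - refine (ax _ (EHA_T (@induction_ax [] p I)) _); cbn [closure]; inst_closed.
  - apply p_andI; [|apply p_allI, p_impI].
    + exact (monus0 _ _).
    + refine (eq_trans (monus_SS _ _ _) _); hyp.
Qed.

(** * Majorisation by the constant 1 and standardness of the two witnesses *)

Lemma le_one_mono G H (a b : tm G N) :
  prov T H (b == Succ @ Zero) -> prov T H (le a (Succ @ Zero)) ->
  prov T H (le a b).
Proof.
  intros h h'; exact (eq_trans (eqt_app2 (s := N) (t := N) _ h) h').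
Qed.

(** Strong majorisation requires the values of [a] and of the constant function to lie below the
    value 1 of the latter: the first bound is the hypothesis, the second is 1 <= 1. *)
Lemma maj_one G H s (a : tm G (s ~> N)) :
  (forall H (b : tm (s :: s :: G) s),
    prov T H (le (wk (wk a) @ b) (Succ @ Zero))) ->
  prov T H (maj a (Pi @ (Succ @ Zero))).
Proof.
  intros h; apply p_allI, p_allI, p_impI, p_andI;
    (apply le_one_mono; [apply (eqt_Pi (s := N) _ _)|]); [apply h|].
  exact (eq_trans (eqt_app1 (t := N) _ (eqt_app2 (t := ty1) monus (eqt_Pi (s := N) _ _ _)))
    (one_le_one _)).
Qed.

Lemma st_threshold G H (x : tm G N) : prov T H (St (threshold @ x)).
Proof.
  refine (p_impE (p_impE _ (ax _ (DG_T (st_closed_ax one_fun)) eq_refl))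
    (maj_one _ (a := threshold @ x) _)).
  - eapply allE with (a := Pi @ (Succ @ Zero)).
    + eapply allE with (a := threshold @ x);
        [refine (ax _ (DG_T (st_maj_ax ty1)) _)|]; reflexivity.
    + inst_closed.
  - intros H' b; unfold wk; cbn; rewrite !(closed_family_ren threshold_closed).
    refine (eq_trans (eqt_app1 (t := N) _
      (eqt_app2 (s := N) (t := ty1) _ (threshold_app _ _ _))) _).
    apply sg_le_one.
Qed.

Lemma st_probe G H (x : tm G N) : prov T H (St (probe @ x)).
Proof.
  refine (p_impE (p_impE _ (ax _ (DG_T (st_closed_ax (Pi @ (Succ @ Zero)))) eq_refl))
    (maj_one _ (a := probe @ x) _)).
  - eapply allE with (a := Pi @ (Succ @ Zero)).
    + eapply allE with (a := probe @ x);
        [refine (ax _ (DG_T (st_maj_ax ty2)) _)|]; reflexivity.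
    + inst_closed.
  - intros H' b; unfold wk; cbn; rewrite !(closed_family_ren probe_closed).
    refine (eq_trans (eqt_app1 (t := N) _ (eqt_app2 (s := N) (t := ty1) _ (probe_app _ _ _))) _).
    apply sg_le_one.
Qed.

(** * A number above all standard ones, and codes of standard initial segments *)

Lemma infinite_number : prov T (G := []) [] (Ex N (AllSt (le `0 `1))).
Proof.
  refine (p_impE _ _).
  - refine (ax _ (DG_T (@I_ax [] N N (le `0 `1) I)) _); reflexivity.
  (* Premise of idealisation: at type 0 majorisation is the order itself, so the bound z is its own
     witness for x. *)
  - apply p_allI, p_impI, p_impI, (exI (a := `0)) with (2 := eq_refl).
    apply p_allI, p_impI; hyp.
Qed.

Lemma threshold_eq0 G H (x n : tm G N) :
  prov T H (le n x) -> prov T H (threshold @ x @ n == Zero).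
Proof.
  intros h; refine (eq_trans (threshold_app _ _ _) _).
  exact (eq_trans (eqt_app2 (s := N) (t := N) _ h) (sg0 _)).
Qed.

(** A standard n lies below the infinite x, so n - x = 0. Here n is variable 0 and x is variable 1;
    the binder inside [AllSt] shifts x to variable 2. *)
Lemma threshold_st H :
  In (AllSt (le `0 `2)) H -> prov T H (St `0) ->
  prov T (G := [N; N]) H (threshold @ `1 @ `0 == Zero).
Proof.
  intros h hst; apply threshold_eq0; refine (p_impE _ hst).
  refine (allE (p := St `0 ==> le `0 `2) (p_hyp _ h) (a := `0) _); inst_closed.
Qed.

(** Besides closedness, these recursion equations are all that the refutations use about [bar]. *)
Definition bar_like (c : forall G, tm G (ty1 ~> N ~> N)) : Prop :=
  forall G H (f : tm G ty1),
    prov T H (c G @ f @ Zero == Zero) /\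
    forall n, prov T H (c G @ f @ (Succ @ n) == Succ @ (pair @ (c G @ f @ n) @ (f @ n))).

Lemma bar_like_bar : bar_like (@bar).
Proof. intros G H f; split; [apply bar0 | apply barS]. Qed.

(** External induction on the length hands the step a standard n. The two functions agree there, so
    equal codes are extended by equal entries. *)
Lemma bar_threshold c (hc : closed_family c) (hb : bar_like c) H :
  In (AllSt (le `0 `1)) H ->
  prov T (G := [N]) H (AllSt (c _ @ (Pi @ Zero) @ `0 == c _ @ (threshold @ `1) @ `0)).
Proof.
  intros h; refine (p_impE _ _).
  - eapply allE with (a := `0);
      [refine (ax _ (DG_T (@st_induction_ax [N]
        (c _ @ (Pi @ Zero) @ `0 == c _ @ (threshold @ `1) @ `0))) _); reflexivity|].
    cbn [closure]; inst_closed.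
  - apply p_andI.
    { exact (eq_trans (proj1 (hb _ _ _)) (eq_sym (proj1 (hb _ _ _)))). }
    apply p_allI, p_impI, p_impI.
    refine (eq_trans (proj2 (hb _ _ _) _) (eq_trans _ (eq_sym (proj2 (hb _ _ _) _)))).
    apply (eqt_app2 (s := N) (t := N)), (eqt_app (s := N) (t := N)).
    + apply (eqt_app2 (s := N) (t := ty1)); hyp.
    + refine (eq_trans (eqt_Pi (s := N) _ _ _) (eq_sym (threshold_st _ _))).
      * right; right; exact (in_map wk_fm _ _ h).
      * hyp.
Qed.

(** * The separating functional and how to reason from it *)

Lemma st_app G H s t (f : tm G (s ~> t)) (a : tm G s) :
  prov T H (St f) -> prov T H (St a) -> prov T H (St (f @ a)).
Proof.
  intros hf ha; refine (p_impE (p_impE _ hf) ha).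
  eapply allE with (a := a); [eapply allE with (a := f)|].
  - refine (ax _ (DG_T (st_app_ax s t)) _); reflexivity.
  - reflexivity.
  - inst_closed.
Qed.

Lemma probe_zero G H (x : tm G N) : prov T H (probe @ x @ (Pi @ Zero) == Zero).
Proof.
  refine (eq_trans (probe_app _ _ _) _).
  exact (eq_trans (eqt_app2 (s := N) (t := N) _ (eqt_Pi (s := N) _ _ _)) (sg0 _)).
Qed.

Lemma probe_threshold G H (x : tm G N) :
  prov T H (probe @ x @ (threshold @ x) == Succ @ Zero).
Proof.
  refine (eq_trans (probe_app _ _ _) _).
  refine (eq_trans (eqt_app2 (s := N) (t := N) _ (threshold_app _ _ _)) _).
  refine (eq_trans (eqt_app2 (s := N) (t := N) _
    (eqt_app2 (s := N) (t := N) _ (monus_S_self _ _))) _).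
  exact (eq_trans (eqt_app2 (s := N) (t := N) _ (sgS _ _)) (sgS _ _)).
Qed.

(** The bounds by 1 serve [BCT_C], equality of codes serves [BCT_C] and [WC_N0], pointwise equality
    serves [SE]; standardness and the inequality of values serve all three. *)
Lemma separating_functional c (hc : closed_family c) (hb : bar_like c) :
  prov T (G := []) [] (Ex ty2 (Ex ty1 (Ex ty1 (separates c `2 `1 `0)))).
Proof.
  refine (p_exE infinite_number _).
  unfold wk_fm; cbn [ren_fm]; rewrite (ren_fm_separates _ _ _ _ hc).
  (* The infinite number is the innermost variable. Under the existential quantifiers still to be
     instantiated it becomes variable 2, then 1, then 0. *)
  apply (exI (a := probe @ `0) (q := Ex ty1 (Ex ty1 (separates c (probe @ `2) `1 `0)))).
  2: { unfold inst; cbn [sub_fm]; rewrite (sub_fm_separates _ _ _ _ hc); reflexivity. }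
  apply (exI (a := Pi @ Zero) (q := Ex ty1 (separates c (probe @ `1) (Pi @ Zero) `0))).
  2: { unfold inst; cbn [sub_fm]; rewrite (sub_fm_separates _ _ _ _ hc); reflexivity. }
  apply (exI (a := threshold @ `0) (q := separates c (probe @ `0) (Pi @ Zero) (threshold @ `0))).
  2: { unfold inst; rewrite (sub_fm_separates _ _ _ _ hc); reflexivity. }
  repeat apply p_andI.
  - apply st_probe.
  - exact (ax _ (DG_T (st_closed_ax (Pi @ Zero))) eq_refl).
  - apply st_threshold.
  - apply p_allI, p_impI.
    refine (eq_trans (eqt_app2 (s := N) (t := N) _ (eqt_Pi (s := N) _ _ _)) _).
    refine (eq_trans (monusS _ _ _) _).
    refine (eq_trans (eqt_app2 (s := N) (t := N) _ (monus0 _ _)) _).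
    refine (eq_trans (eqt_app2 (s := N) (t := N) _ (eqt_Pi (s := N) _ _ _)) _).
    apply pred0.
  - apply p_allI, p_impI.
    apply le_one_mono; [exact (eqt_Pi (s := N) _ _ _)|].
    unfold wk; cbn; rewrite (closed_family_ren threshold_closed).
    refine (eq_trans (eqt_app1 (t := N) _
      (eqt_app2 (s := N) (t := ty1) _ (threshold_app _ _ _))) _).
    apply sg_le_one.
  - apply p_allI, p_impI.
    refine (eq_trans (eqt_Pi (s := N) _ _ _) (eq_sym _)).
    unfold wk; cbn [ren_tm]; rewrite (closed_family_ren threshold_closed).
    apply threshold_st; [right; left; reflexivity | hyp].
  - unfold wk; cbn [ren_tm]; rewrite (closed_family_ren threshold_closed).
    apply (bar_threshold hc hb); left; reflexivity.
  (* Equal values would give 1 = Y(g) = Y(0) = 0. *)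
  - apply p_impI; refine (p_impE (p := Succ @ Zero == Zero) _ _).
    + eapply allE with (a := Zero);
        [refine (ax _ (EHA_T succ_neq0_ax) _)|]; reflexivity.
    + refine (eq_trans (eq_sym (probe_threshold _ `0)) (eq_sym _)).
      refine (eq_trans (eq_sym (probe_zero _ `0)) _); hyp.
Qed.

Lemma inconsistent_of_separates c (hc : closed_family c) (hb : bar_like c) :
  (forall H, In (separates c `2 `1 `0) H ->
    prov T (G := [ty1; ty1; ty2]) H Bot) ->
  inconsistent T.
Proof.
  intros h.
  refine (p_exE (separating_functional hc hb) _).
  refine (p_exE (p := Ex ty1 (separates c `2 `1 `0)) (p_hyp _ _) _);
    [left; reflexivity|].
  refine (p_exE (p := separates c `2 `1 `0) (p_hyp _ _) _); [left; reflexivity|].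
  apply h; left; reflexivity.
Qed.

Lemma separates_parts G H c Y f g :
  In (separates c Y f g) H ->
  (prov T (G := G) H (St Y) /\ prov T H (St f) /\ prov T H (St g)) /\
  (prov T H (AllSt (le (wk f @ `0) (one_fun @ `0))) /\
   prov T H (AllSt (le (wk g @ `0) (one_fun @ `0)))) /\
  prov T H (AllSt (wk f @ `0 == wk g @ `0)) /\
  prov T H (AllSt (c _ @ wk f @ `0 == c _ @ wk g @ `0)) /\
  prov T H (Neg (Y @ f == Y @ g)).
Proof.
  intros h; apply (p_hyp T) in h; repeat split;
    repeat (first [exact (p_andE1 h) | exact h | apply p_andE2 in h]).
Qed.

Lemma wk_separates G H c (hc : closed_family c) s Y f g :
  In (separates c Y f g) H ->
  In (separates c (wk Y) (wk f) (wk g)) (map (@wk_fm G s) H).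
Proof.
  intros h; unfold wk; rewrite <- ren_fm_separates by exact hc.
  exact (in_map wk_fm _ _ h).
Qed.

(** Falsity is unchanged by weakening, so a further existential can be opened. The new hypotheses
    enter as an arbitrary list [K], which keeps repeated eliminations free of explicitly weakened
    formulas. *)
Lemma exE_separates G H c (hc : closed_family c) Y f g s (p : fm (s :: G)) :
  In (separates c Y f g) H -> prov T H (Ex s p) ->
  (forall K, (forall q, In q H -> In (wk_fm q) K) ->
    In (separates c (wk Y) (wk f) (wk g)) K ->
    prov T K p -> prov T K Bot) ->
  prov T H Bot.
Proof.
  intros hs h hK; refine (p_exE (q := Bot) h (hK _ _ _ _)); [| right | hyp].
  - intros q hq; right; exact (in_map wk_fm _ _ hq).
  - apply (wk_separates hc), hs.
Qed.

End ExtensionsOfDG.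

(** * Refutation of the three relativised principles *)

Ltac norm_in h :=
  unfold inst, lift, wk_fm, AllSt, ExSt, Neg in h;
  repeat (progress (cbn in h; unfold wk, shift in h));
  repeat (first
    [ match goal with hc : closed_family _ |- _ =>
        first [ rewrite (closed_family_ren hc) in h | rewrite (closed_family_sub hc) in h ] end
    | rewrite (closed_family_ren monus_closed) in h
    | rewrite (closed_family_sub monus_closed) in h ]).

Tactic Notation "spec_st" hyp(h) uconstr(a) constr(st) :=
  apply (p_allE a) in h; norm_in h; apply (fun k => p_impE k st) in h.

(** Taking [bar] for [c] gives the sentence of [BCT_C]; a variable [c] keeps [bar] from being
    unfolded while instances are normalised. *)
Definition BCT_with (c : forall G, tm G (ty1 ~> N ~> N)) : sentence :=
  All ty2 (All ty1 (le `0 one_fun ==> Ex N (All ty1 (le `0 one_fun ==>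
    c _ @ `2 @ `1 == c _ @ `0 @ `1 ==> `3 @ `2 == `3 @ `0)))).

(** Relativising f <= 1 bounds f at standard arguments only, which is what [separates] provides. The
    modulus obtained for Y and f is standard, so the codes of f and g agree at it and Y(f) = Y(g)
    follows. *)
Lemma BCT_refuted (T : theory) (DG_T : forall p, DG p -> T p) c
    (hc : closed_family c) (hb : bar_like T c) :
  T (rel (BCT_with c)) -> inconsistent T.
Proof.
  intros hT; apply (inconsistent_of_separates DG_T hc hb); intros H hs.
  destruct (separates_parts T hs) as ((stY & stf & stg) & (lef & leg) & _).
  pose proof (p_ax (G := [ty1; ty1; ty2]) H hT) as h; norm_in h.
  spec_st h `2 stY; spec_st h `1 stf; apply (fun k => p_impE k lef) in h.
  apply (exE_separates hc hs h); clear hs h stY stf stg lef leg; intros K _ hs h.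
  destruct (separates_parts T hs) as
    ((stY & stf & stg) & (lef & leg) & _ & hbar & hneq).
  refine (p_impE hneq _).
  pose proof (p_andE1 h) as stn; apply p_andE2 in h.
  spec_st h `1 stg; apply (fun k => p_impE k leg) in h.
  refine (p_impE h _).
  spec_st hbar `0 stn; exact hbar.
Qed.

Definition WC_with (c : forall G, tm G (ty1 ~> N ~> N)) (A : fm [N; ty1; ty2]) :
    sentence :=
  All ty2 (All ty1 (Ex N A) ==>
    All ty1 (Ex N (Ex N (All ty1
      (c _ @ `3 @ `2 == c _ @ `0 @ `2 ==> ren_fm WC_ren A))))).

(** For A(a,n) := Y(a) = n the conclusion at f gives standard n and m such that Y(b) = m for every
    standard b whose code at n is that of f. Both f and g qualify, so Y(f) = m = Y(g). *)
Lemma WC_refuted (T : theory) (DG_T : forall p, DG p -> T p) c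
    (hc : closed_family c) (hb : bar_like T c) :
  T (rel (WC_with c (`2 @ `1 == `0))) -> inconsistent T.
Proof.
  intros hT; apply (inconsistent_of_separates DG_T hc hb); intros H hs.
  destruct (separates_parts T hs) as ((stY & stf & stg) & _).
  pose proof (p_ax (G := [ty1; ty1; ty2]) H hT) as h; norm_in h.
  spec_st h `2 stY.
  refine ((fun k => _) (p_impE h _)); clear h.
  (* Premise of the schema: n is Y(a), standard because Y and a are. *)
  2: { apply p_allI, p_impI.
    apply (exI (a := `3 @ `0) (q := St (`3 @ `0) & `3 @ `0 == `3 @ `0)); [|reflexivity].
    apply p_andI; [|exact (eqt_refl DG_T (s := N) _ _)].
    apply (st_app DG_T); [|hyp].
    apply (wk_separates hc ty1) in hs.
    refine (proj1 (proj1 (separates_parts T (Y := `3) (f := `2) (g := `1) _))).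
    right; exact hs. }
  rename k into h; spec_st h `1 stf.
  apply (exE_separates hc hs h); clear hs h stY stf stg; intros K _ hs h.
  (* Both conjuncts become hypotheses, so that the standardness of n is carried through the opening
     of the second existential, where equality of the codes at n requires it. *)
  refine (p_impE (p_impE (p_impI (p_impI _)) (p_andE2 h)) (p_andE1 h)); clear h.
  refine (exE_separates hc (or_intror (or_intror hs) : In _ (_ :: _ :: K))
    (p_hyp _ (or_intror (or_introl eq_refl) : In _ (_ :: _ :: K))) _).
  clear hs; intros L hK hs h.
  assert (stn := p_hyp T (hK _ (or_introl eq_refl))).
  destruct (separates_parts T hs) as ((stY & stf & stg) & _ & _ & hbar & hneq).
  spec_st hbar `1 stn; apply p_andE2 in h.
  refine (p_impE hneq (eq_trans DG_T (b := `0) _ (eq_sym DG_T _))).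
  - spec_st h `3 stf; exact (p_impE h (eqt_refl DG_T (s := N) _ _)).
  - spec_st h `2 stg; exact (p_impE h hbar).
Qed.

(** Relativised, the conclusion demands a standard argument at which f and g differ, whereas they
    agree at all standard ones. *)
Lemma SE_refuted (T : theory) (DG_T : forall p, DG p -> T p) c
    (hc : closed_family c) (hb : bar_like T c) :
  T (rel (All ty2 (All ty1 (All ty1
      (Neg (`2 @ `1 == `2 @ `0) ==> Ex N (Neg (`2 @ `0 == `1 @ `0))))))) ->
  inconsistent T.
Proof.
  intros hT; apply (inconsistent_of_separates DG_T hc hb); intros H hs.
  destruct (separates_parts T hs) as ((stY & stf & stg) & _ & _ & _ & hneq).
  pose proof (p_ax (G := [ty1; ty1; ty2]) H hT) as h; norm_in h.
  spec_st h `2 stY; spec_st h `1 stf; spec_st h `0 stg.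
  apply (fun k => p_impE k hneq) in h.
  apply (exE_separates hc hs h); clear hs h stY stf stg hneq; intros K _ hs h.
  destruct (separates_parts T hs) as (_ & _ & heq & _).
  refine (p_impE (p_andE2 h) _); apply p_andE1 in h.
  spec_st heq `0 h; exact heq.
Qed.

Theorem theorem3p20 :
  inconsistent (DG +++ relativised BCT_C) /\
  inconsistent (DG +++ relativised WC_N0) /\
  inconsistent (DG +++ relativised SE).
Proof.
  split; [|split].
  - assert (DG_T : forall p, DG p -> (DG +++ relativised BCT_C) p) by (left; assumption).
    apply (BCT_refuted DG_T bar_closed (bar_like_bar DG_T)).
    right; exists (BCT_with (@bar)); split; [exact BCT_C_ax | reflexivity].
  - assert (DG_T : forall p, DG p -> (DG +++ relativised WC_N0) p) by (left; assumption).
    apply (WC_refuted DG_T bar_closed (bar_like_bar DG_T)).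
    right; exists (WC_with (@bar) (`2 @ `1 == `0)); split; [|reflexivity].
    (* Y enters as the one parameter of A, so the relativised closure ranges over standard Y. *)
    exact (WC_N0_ax (G := [ty2]) (A := `2 @ `1 == `0) I I).
  - assert (DG_T : forall p, DG p -> (DG +++ relativised SE) p) by (left; assumption).
    apply (SE_refuted DG_T bar_closed (bar_like_bar DG_T)).
    right; eexists; split; [exact SE_ax | reflexivity].
Qed.
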